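(* Let $\varphi:M\to N$ be a smooth map from a Riemannian manifold $(M^m,g)$ to a Kähler manifold $(N^{2n},J,h)$ (of real dimension $2n$), and let $V$ be a smooth vector field on $M$. Then $\varphi$ is a $V$-pseudo harmonic morphism if and only if it pulls back local complex-valued holomorphic functions on $N$ to local $V$-harmonic functions on $M$, i.e. for every holomorphic function $f:W\to\mathbb{C}$ on an open subset $W\subset N$ with $\varphi^{-1}(W)\neq\emptyset$, the function $f\circ\varphi:\varphi^{-1}(W)\to\mathbb{C}$ is $V$-harmonic.
   Context: For a smooth map $\varphi:(M,g)\to(N,h)$ between Riemannian manifolds, the tension field is $\tau(\varphi)=\mathrm{trace}_g\nabla d\varphi\in\Gamma(\varphi^{-1}TN)$. For a smooth vector field $V$ on $M$, the $V$-tension field is $\tau_V(\varphi)=\tau(\varphi)+d\varphi(V)$, and $\varphi$ is $V$-harmonic if $\tau_V(\varphi)=0$. For a real- or complex-valued function $f$ on an open subset of $M$ this reads $\Delta_V f:=\Delta f+\langle V,\nabla f\rangle=0$ (equivalently $\Delta f+V(f)=0$), with $\Delta=\mathrm{trace}\,\nabla d$. For $x\in M$, let $d\varphi_x^*:T_{\varphi(x)}N\to T_xM$ denote the adjoint of $d\varphi_x$ with respect to $g$ and $h$. When $(N,J,h)$ is (almost) Hermitian, $\varphi$ is pseudo-horizontally weakly conformal (PHWC) if $[d\varphi_x\circ d\varphi_x^*,J_{\varphi(x)}]=0$ for every $x\in M$. The map $\varphi$ is called a $V$-pseudo harmonic morphism ($V$-PHM) if it is both $V$-harmonic and PHWC.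 *)

(* Defs.v *)
From mathcomp Require Import all_boot all_order all_algebra.
From mathcomp Require Import complex.
From mathcomp Require Import all_classical all_reals all_analysis.

Set Implicit Arguments.
Unset Strict Implicit.
Unset Printing Implicit Defensive.

Import Order.TTheory GRing.Theory Num.Theory.
Import numFieldNormedType.Exports.

Local Open Scope classical_set_scope.
Local Open Scope ring_scope.

(* Conventions.  Tangent vectors are row vectors of components and linear maps
   act on the right: the differential of F at u is v |-> v *m 'J F u.  Tensor
   fields are given by their components in every chart, as functions of the
   coordinates, together with their transformation law.  Functions are total;
   values outside of the stated domains are irrelevant. *)

Section Calculus.
Context {R : realType} {m : nat}.

Definition pderiv {E : normedModType R} (a : 'I_m) (F : 'rV[R]_m -> E) :
  'rV[R]_m -> E := fun u => 'D_(delta_mx 0 a) F u.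

(* C^infinity on U (an open set in all uses): every iterated partial derivative
   of F exists and is Frechet differentiable, hence continuous, on U. *)
Definition smooth_on {E : normedModType R} (U : set 'rV[R]_m)
    (F : 'rV[R]_m -> E) : Prop :=
  forall (s : seq 'I_m) (u : 'rV[R]_m), U u ->
    differentiable (foldr pderiv F s) u.

(* Gamma^k_ab of the Levi-Civita connection of the metric G. *)
Definition christoffel (G : 'rV[R]_m -> 'M[R]_m) (u : 'rV[R]_m)
    (a b k : 'I_m) : R :=
  2^-1 * \sum_(l < m) invmx (G u) k l *
    (pderiv a G u b l + pderiv b G u a l - pderiv l G u a b).

(* (nabla dF)(d_a, d_b) for a function F with values in a vector space. *)
Definition hessian {E : normedModType R} (G : 'rV[R]_m -> 'M[R]_m)
    (F : 'rV[R]_m -> E) (u : 'rV[R]_m) (a b : 'I_m) : E :=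
  pderiv a (pderiv b F) u - \sum_(k < m) christoffel G u a b k *: pderiv k F u.

Definition trace_form {E : normedModType R} (g : 'M[R]_m)
    (B : 'I_m -> 'I_m -> E) : E :=
  \sum_(a < m) \sum_(b < m) invmx g a b *: B a b.

End Calculus.

Record manifold (R : realType) (m : nat) := Manifold {
  space :> topologicalType;
  chart_index : Type;
  dom : chart_index -> set space;
  chart : chart_index -> space -> 'rV[R]_m;
  param : chart_index -> 'rV[R]_m -> space;
  space_hausdorff : hausdorff_space space;
  space_second_countable : @second_countable space;
  dom_open : forall i, open (dom i);
  dom_cover : forall x, exists i, dom i x;
  chart_codom_open : forall i, open (chart i @` dom i);
  chartK : forall i x, dom i x -> param i (chart i x) = x;
  chart_continuous : forall i x, dom i x -> {for x, continuous (chart i)};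
  param_continuous : forall i x, dom i x ->
    {for chart i x, continuous (param i)};
  transition_smooth : forall i j,
    smooth_on (chart i @` (dom i `&` dom j)) (chart j \o param i)
}.
Arguments chart_index {R m} _.
Arguments dom {R m} {_} i.
Arguments chart {R m} {_} i.
Arguments param {R m} {_} i.

Section Geometry.
Context {R : realType} {m : nat}.
Implicit Type M : manifold R m.

Definition transition_jac M (i j : chart_index M) (x : M) : 'M[R]_m :=
  'J (chart j \o param i) (chart i x).

Record vector_field M := VectorField {
  vf_comp :> forall i : chart_index M, 'rV[R]_m -> 'rV[R]_m;
  vf_smooth : forall i, smooth_on (chart i @` dom i) (vf_comp i);
  vf_transition : forall i j (x : M), dom i x -> dom j x ->
    vf_comp j (chart j x) = vf_comp i (chart i x) *m transition_jac i j x
}.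

Record riemannian_metric M := RiemannianMetric {
  metric_comp :> forall i : chart_index M, 'rV[R]_m -> 'M[R]_m;
  metric_smooth : forall i, smooth_on (chart i @` dom i) (metric_comp i);
  metric_sym : forall i x, dom i x ->
    (metric_comp i (chart i x))^T = metric_comp i (chart i x);
  metric_pos : forall i x, dom i x -> forall v : 'rV[R]_m, v != 0 ->
    0 < (v *m metric_comp i (chart i x) *m v^T) 0 0;
  metric_transition : forall i j (x : M), dom i x -> dom j x ->
    metric_comp i (chart i x) =
      transition_jac i j x *m metric_comp j (chart j x)
        *m (transition_jac i j x)^T
}.

Definition smooth_function_on M (O : set M) (f : M -> R) : Prop :=
  forall i, smooth_on (chart i @` (dom i `&` O)) (f \o param i : _ -> R^o).

(* Delta_V f = Delta f + V(f), in the chart i and at the coordinates u. *)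
Definition V_laplacian M (g : riemannian_metric M) (V : vector_field M)
    (f : M -> R) (i : chart_index M) (u : 'rV[R]_m) : R :=
  let F : 'rV[R]_m -> R^o := f \o param i in
  trace_form (g i u) (hessian (g i) F u) + 'd F u (V i u).

Definition real_V_harmonic_on M (g : riemannian_metric M) (V : vector_field M)
    (O : set M) (f : M -> R) : Prop :=
  smooth_function_on O f /\
  forall i x, dom i x -> O x -> V_laplacian g V f i (chart i x) = 0.

(* Delta_V is extended C-linearly to complex-valued functions. *)
Definition V_harmonic_on M (g : riemannian_metric M) (V : vector_field M)
    (O : set M) (f : M -> R[i]) : Prop :=
  real_V_harmonic_on g V O (@complex.Re R \o f) /\
  real_V_harmonic_on g V O (@complex.Im R \o f).

End Geometry.

Section Maps.
Context {R : realType} {m p : nat}.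
Variables (M : manifold R m) (N : manifold R p).

Definition local_rep (phi : M -> N) (i : chart_index M) (j : chart_index N) :
  'rV[R]_m -> 'rV[R]_p := chart j \o phi \o param i.

Definition smooth_map (phi : M -> N) : Prop :=
  continuous phi /\
  forall i j,
    smooth_on (chart i @` (dom i `&` phi @^-1` dom j)) (local_rep phi i j).

Variables (g : riemannian_metric M) (h : riemannian_metric N).

(* (nabla d phi)(d_a, d_b), in the charts i of M and j of N, where nabla is
   induced by the Levi-Civita connections of M and N. *)
Definition second_fundamental_form (phi : M -> N) i j (u : 'rV[R]_m)
    (a b : 'I_m) : 'rV[R]_p :=
  let F := local_rep phi i j in
  hessian (g i) F u a b +
  \row_c \sum_(d < p) \sum_(e < p)
    christoffel (h j) (F u) d e c * pderiv a F u 0 d * pderiv b F u 0 e.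

Definition tension (phi : M -> N) i j (u : 'rV[R]_m) : 'rV[R]_p :=
  trace_form (g i u) (second_fundamental_form phi i j u).

Definition V_tension (V : vector_field M) (phi : M -> N) i j (u : 'rV[R]_m) :
  'rV[R]_p := tension phi i j u + 'd (local_rep phi i j) u (V i u).

Definition V_harmonic_map (V : vector_field M) (phi : M -> N) : Prop :=
  forall i j x, dom i x -> dom j (phi x) -> V_tension V phi i j (chart i x) = 0.

End Maps.

(* Matrix of the adjoint of v |-> v *m A with respect to the inner products
   G (source) and H (target). *)
Definition adjoint_mx {R : realType} {m p : nat} (G : 'M[R]_m) (H : 'M[R]_p)
    (A : 'M[R]_(m, p)) : 'M[R]_(p, m) := H *m A^T *m invmx G.

Lemma adjoint_mxP {R : realType} {m p : nat} (G : 'M[R]_m) (H : 'M[R]_p)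
    (A : 'M[R]_(m, p)) (v : 'rV[R]_m) (w : 'rV[R]_p) :
  G \in unitmx -> G^T = G -> H^T = H ->
  (v *m A) *m H *m w^T = v *m G *m (w *m adjoint_mx G H A)^T.
Proof.
move=> uG sG sH.
by rewrite /adjoint_mx !trmx_mul trmx_inv trmxK sG sH !mulmxA mulmxK.
Qed.

(* C^n is identified with R^(n + n) by x + i y |-> row_mx x y; this is the
   matrix of multiplication by i. *)
Definition Jmx (R : realType) (n : nat) : 'M[R]_(n + n) :=
  block_mx 0 1%:M (- 1%:M) 0.

Record complex_manifold (R : realType) (n : nat) := ComplexManifold {
  cm_manifold :> manifold R (n + n);
  (* Cauchy-Riemann equations: the (smooth) transition maps are holomorphic.
     Hence the almost complex structure J of the manifold, which has the matrix
     Jmx in every chart, is well defined. *)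
  cm_transition : forall (i j : chart_index cm_manifold) (x : cm_manifold),
    dom i x -> dom j x -> comm_mx (transition_jac i j x) (Jmx R n)
}.

Section Complex.
Context {R : realType} {n : nat}.

(* Matrix of the fundamental form (v, w) |-> h(J v, w). *)
Definition kahler_form (N : complex_manifold R n) (h : riemannian_metric N)
    (i : chart_index N) (u : 'rV[R]_(n + n)) : 'M[R]_(n + n) :=
  Jmx R n *m h i u.

Definition cdiff (F : 'rV[R]_(n + n) -> R[i]) (u v : 'rV[R]_(n + n)) : R[i] :=
  Complex ('d (@complex.Re R \o F : _ -> R^o) u v)
          ('d (@complex.Im R \o F : _ -> R^o) u v).

(* f is smooth on W and df o J = i df there. *)
Definition holomorphic_on (N : complex_manifold R n) (W : set N)
    (f : N -> R[i]) : Prop :=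
  [/\ smooth_function_on W (@complex.Re R \o f),
      smooth_function_on W (@complex.Im R \o f)
    & forall i x, dom i x -> W x -> forall v : 'rV[R]_(n + n),
        cdiff (f \o param i) (chart i x) (v *m Jmx R n) =
          'i%C * cdiff (f \o param i) (chart i x) v].

End Complex.

Record kahler_manifold (R : realType) (n : nat) := KahlerManifold {
  kahler_complex :> complex_manifold R n;
  kahler_metric : riemannian_metric kahler_complex;
  kahler_hermitian : forall (i : chart_index kahler_complex) x, dom i x ->
    Jmx R n *m kahler_metric i (chart i x) *m (Jmx R n)^T =
      kahler_metric i (chart i x);
  (* the exterior derivative of the fundamental form vanishes *)
  kahler_closed : forall (i : chart_index kahler_complex) x, dom i x ->
    let w := kahler_form kahler_metric i in
    forall a b c,
      pderiv a w (chart i x) b c + pderiv b w (chart i x) c a +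
        pderiv c w (chart i x) a b = 0
}.

Section PHM.
Context {R : realType} {m n : nat}.
Variables (M : manifold R m) (g : riemannian_metric M).
Variables (N : kahler_manifold R n).

(* d phi_x o (d phi_x)^* commutes with J at phi x. *)
Definition PHWC (phi : M -> N) : Prop :=
  forall (i : chart_index M) (j : chart_index N) x, dom i x -> dom j (phi x) ->
    let A := 'J (local_rep phi i j) (chart i x) in
    let A_adj :=
      adjoint_mx (g i (chart i x)) (kahler_metric N j (chart j (phi x))) A in
    comm_mx (A_adj *m A) (Jmx R n).

Definition V_pseudo_harmonic_morphism (V : vector_field M) (phi : M -> N) :
  Prop := V_harmonic_map g (kahler_metric N) V phi /\ PHWC phi.

End PHM.

(* Main.v *)
Require Import Defs.
From mathcomp Require Import all_boot all_order all_algebra.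
From mathcomp Require Import complex.
From mathcomp Require Import all_classical all_reals all_analysis.
From mathcomp Require Import ring lra.

(* In charts, the chain rule reads
     Delta_V (P o phi) = dP (tau_V phi) + tr (C B),
   where C = A^T g^-1 A for A the matrix of d phi and B is the covariant Hessian
   of P.  Closedness of the fundamental form makes the Christoffel symbols
   commute with J, so, by the Cauchy-Riemann equations and the symmetry of second
   derivatives, B anticommutes with J when P is the real or imaginary part of a
   holomorphic function.  PHWC means that C commutes with J, which forces
   tr (C B) = 0.  Conversely, holomorphic polynomials of degree two in the
   coordinates of a chart have every symmetric B anticommuting with J as Hessian
   at a critical point; B = C + J C J gives tr (B B) = 2 tr (C B) = 0, i.e. PHWC.
   Linear polynomials then give tau_V phi = 0. *)

Set Implicit Arguments.
Unset Strict Implicit.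
Unset Printing Implicit Defensive.

Import Order.TTheory GRing.Theory Num.Theory.
Import numFieldNormedType.Exports.

Local Open Scope classical_set_scope.
Local Open Scope ring_scope.

(** * Locality of differentiability and symmetry of second derivatives *)

Lemma near_eq_differentiable (R : numFieldType) (V W : normedModType R)
    (f g : V -> W) (x : V) :
  (\near x, f x = g x) -> differentiable f x -> differentiable g x.
Proof.
move=> fg /diff_locallyP[df fx].
have gx : g \o shift x = cst (g x) + 'd f x +o_ 0 id.
  apply/eqaddoP => _/posnumP[e].
  move: fx => /eqaddoP /(_ _ (gt0 e)) fx.
  have fgx := nbhs_singleton fg.
  move/nbhs0P : fg; move: fx; apply: filterS2 => y fxy E.
  by move: fxy; rewrite !fctE /= fgx [y + x]addrC E.
have dgE := diff_unique df gx.
by apply/diff_locallyP; rewrite dgE.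
Qed.

Section Young.
Context {R : realType} {V : normedModType R}.
Implicit Types (f : V -> R^o) (x v w : V).

Lemma is_derive_line f v y (s : R) : differentiable f (s *: v + y) ->
  is_derive s 1 (fun t : R => f (t *: v + y) : R^o) ('D_v f (s *: v + y)).
Proof.
move=> df.
have E : (fun h : R => h^-1 *: (f ((h *: 1 + s) *: v + y) - f (s *: v + y))) =
         (fun h : R => h^-1 *: (f (h *: v + (s *: v + y)) - f (s *: v + y))).
  apply/funext => h; rewrite /= scalerDl -addrA; congr (_ *: (f (_ *: _ + _) - _)).
  exact: mulr1.
by apply: DeriveDef; rewrite /derivable /derive /= E //; exact: diff_derivable.
Qed.

(* Mean value theorem in the direction [v], then differentiability of ['D_v f] at
   [x]; the second difference is symmetric in [v] and [w]. *)
Lemma second_difference_le f x v w (e : R) : 0 < e ->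
  (\near x, differentiable f x) -> differentiable ('D_v f) x ->
  \forall t \near 0^'+,
    `|f (t *: v + (t *: w + x)) - f (t *: v + x) - (f (t *: w + x) - f x)
      - t ^+ 2 * 'D_w ('D_v f) x| <= e * t ^+ 2.
Proof.
move=> e0 dfx dfv; set G := 'D_v f.
(* For [0 <= s <= t] the norms of [s *: v + t *: w] and [s *: v] add up to at most
   [t * (2 * |v| + |w|)]; adding 1 makes the factor positive, so that [e / C] makes sense. *)
pose C := 2 * `|v| + `|w| + 1.
have C0 : 0 < C by rewrite ltr_wpDl ?addr_ge0 ?mulr_ge0.
have eC0 : 0 < e / C by rewrite divr_gt0.
have /diff_locally /eqaddoP /(_ _ eC0) G1 := dfv.
have [r /= r0 Hr] : exists2 r : R, 0 < r & forall h : V, `|h| < r ->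
   differentiable f (h + x) /\ `|G (h + x) - G x - 'd G x h| <= e / C * `|h|.
  have /nbhs_normP[r r0 H] : \forall h \near 0, differentiable f (h + x) /\
      `|G (h + x) - G x - 'd G x h| <= e / C * `|h|.
    move/nbhs0P : dfx; move: G1; apply: filterS2 => h; rewrite /= !fctE => G1.
    by rewrite addrC; split=> //; move: G1; rewrite opprD addrA.
  by exists r => // h hr; apply: H; rewrite /ball_ /= sub0r normrN.
near=> t.
have t0 : 0 < t by [].
have tC : t * C < r.
  by rewrite -ltr_pdivlMr //; near: t; apply: nbhs_right_lt; rewrite divr_gt0.
(* The second difference is [phi t - phi 0], which the mean value theorem turns into [t] times an
   increment of [G]. *)
pose phi (s : R) : R^o := f (s *: v + (t *: w + x)) - f (s *: v + x).
have nrm (s : R) : 0 <= s <= t ->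
   `|s *: v + t *: w| < r /\ `|s *: v| < r.
  move=> /andP[s0 st].
  have s1 : `|s *: v| <= t * `|v| by rewrite normrZ ger0_norm // ler_wpM2r.
  split.
    apply: le_lt_trans tC; apply: (le_trans (ler_normD _ _)).
    rewrite [X in _ + X]normrZ (gtr0_norm t0) /C.
    by have := normr_ge0 v; have := normr_ge0 w; nra.
  apply: le_lt_trans s1 _; apply: lt_trans tC; rewrite ltr_pM2l // /C.
  by have := normr_ge0 v; have := normr_ge0 w; lra.
have dphi (s : R) : 0 <= s <= t ->
    is_derive s 1 phi (G (s *: v + (t *: w + x)) - G (s *: v + x)).
  move=> st; have [n1 n2] := nrm s st.
  apply: is_deriveB; apply: is_derive_line.
    by rewrite addrA; apply: (Hr _ n1).1.
  exact: (Hr _ n2).1.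
have [||s st] := @MVT R phi
  (fun s => G (s *: v + (t *: w + x)) - G (s *: v + x)) 0 t t0.
- by move=> s; rewrite in_itv /= => /andP[s0 st]; apply: dphi; rewrite !ltW.
- apply: derivable_within_continuous => s; rewrite in_itv /= => st.
  by have [] := dphi _ st.
rewrite subr0 /phi !scale0r !add0r => ->.
have {}st : 0 <= s <= t by move: st; rewrite in_itv /= => /andP[? ?]; rewrite !ltW.
have [n1 n2] := nrm s st.
have [_ g1] := Hr _ n1; have [_ g2] := Hr _ n2.
rewrite (deriveE _ dfv).
have dt : 'd G x (t *: w) = t * 'd G x w by rewrite linearZ.
move: g1; rewrite linearD /= dt addrA => g1.
have st1 : `|s *: v| <= t * `|v|.
  by case/andP: st => s0 st; rewrite normrZ ger0_norm // ler_wpM2r.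
have st2 : `|s *: v + t *: w| <= t * (`|v| + `|w|).
  by rewrite (le_trans (ler_normD _ _)) // mulrDr lerD // normrZ gtr0_norm.
have eE : e * t ^+ 2 = (e / C * (t * C)) * t by field; rewrite gt_eqF.
(* By linearity of ['d G x], the error is [t] times the difference of the remainders of [G] at two
   points near [x], and [G1] bounds each of them. *)
rewrite (_ : _ - _ =
  ((G (s *: v + t *: w + x) - G x - ('d G x (s *: v) + t * 'd G x w))
   - (G (s *: v + x) - G x - 'd G x (s *: v))) * t); last by ring.
rewrite normrM (gtr0_norm t0) eE ler_pM2r //.
apply: le_trans (ler_normB _ _) _; apply: (le_trans (lerD g1 g2)).
rewrite -mulrDr ler_wpM2l ?(ltW eC0) //.
by rewrite /C; nra.
Unshelve. all: by end_near. Qed.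

(** Divided by [t ^+ 2], the same second difference is within [e / 2] of either side, so one [t > 0]
    satisfying both estimates shows that the sides differ by at most [e]. *)
Lemma derive_swap f x v w :
  (\near x, differentiable f x) -> differentiable ('D_v f) x ->
  differentiable ('D_w f) x ->
  'D_w ('D_v f) x = 'D_v ('D_w f) x.
Proof.
move=> fx fv fw.
apply/eqP; rewrite -subr_eq0 -normr_le0; apply/ler_addgt0Pl => e e0; rewrite addr0.
have e20 : 0 < e / 2 by rewrite divr_gt0.
have [t [t0 [H1 H2]]] := filter_ex (filterI (nbhs_right_gt (0 : R))
  (filterI (second_difference_le w e20 fx fv) (second_difference_le v e20 fx fw))).
have key (a b c d T L1 L2 k : R) : `|a - b - (c - d) - T * L1| <= k * T ->
    `|a - c - (b - d) - T * L2| <= k * T -> `|T * (L1 - L2)| <= (k + k) * T.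
  move=> h1 h2; rewrite mulrDl; apply: le_trans (lerD h1 h2).
  rewrite [X in _ <= X + _]distrC; apply: le_trans (ler_normD _ _).
  by rewrite le_eqVlt; apply/orP; left; apply/eqP; congr `|_|; ring.
rewrite [t *: w + (t *: v + x)]addrCA in H2.
have := key _ _ _ _ _ _ _ _ H1 H2.
by rewrite normrM -splitr gtr0_norm ?exprn_gt0 // mulrC ler_pM2r // exprn_gt0.
Qed.

End Young.

(** * Classes of differentiability and their closure properties *)

Lemma near_eq_in (T : topologicalType) (E : Type) (U : set T) (F G : T -> E) u :
  open U -> {in U, F =1 G} -> U u -> \near u, F u = G u.
Proof.
move=> oU FG Uu; near=> v; apply: FG; rewrite inE.
by near: v; apply: open_nbhs_nbhs.
Unshelve. all: by end_near. Qed.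

Section Ck.
Context {R : realType} {m : nat}.
Implicit Types (k : nat) (U : set 'rV[R]_m).

(* Derivatives up to order k are required to be differentiable, which is slightly
   more than being of class C^k. *)
Fixpoint Ck {E : normedModType R} k U (F : 'rV[R]_m -> E) : Prop :=
  (forall u, U u -> differentiable F u) /\
  (if k is k'.+1 then forall a, Ck k' U (pderiv a F) else True).

(** The recursive form allows induction on the order with a varying function. [Ck] differentiates
    [F] first, while [foldr] applies the last index of the list first, hence the use of [rcons]. *)
Lemma smooth_onP {E : normedModType R} U (F : 'rV[R]_m -> E) :
  smooth_on U F <-> forall k, Ck k U F.
Proof.
split=> [sF k|CF s].
  elim: k F sF => [|k IH] F sF; split=> //; try by move=> u /(sF [::] u).
  by move=> a; apply: IH => s u /(sF (rcons s a) u); rewrite foldr_rcons.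
elim/last_ind: s F CF => [|s a IH] F CF u Uu.
  by have [+ _] := CF 0; apply.
by rewrite foldr_rcons; apply: IH => // k; have [_ ] := CF k.+1; apply.
Qed.

Lemma Ck_differentiable {E : normedModType R} k U (F : 'rV[R]_m -> E) u :
  Ck k U F -> U u -> differentiable F u.
Proof. by case: k => [|k] [+ _]; apply. Qed.

Lemma CkW {E : normedModType R} k U (F : 'rV[R]_m -> E) :
  Ck k.+1 U F -> Ck k U F.
Proof.
elim: k F => [|k IH] F; first by case.
by move=> [dF HF]; split=> // a; apply/IH/HF.
Qed.

Lemma pderiv_eq {E : normedModType R} a U (F G : 'rV[R]_m -> E) u :
  open U -> {in U, F =1 G} -> U u -> pderiv a F u = pderiv a G u.
Proof.
by move=> oU FG Uu; apply: near_eq_derive; exact: near_eq_in Uu.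
Qed.

Lemma Ck_eq {E : normedModType R} k U (F G : 'rV[R]_m -> E) :
  open U -> {in U, F =1 G} -> Ck k U F -> Ck k U G.
Proof.
move=> oU; elim: k F G => [|k IH] F G FG [dF CF].
  split; last by [].
  by move=> u Uu; apply: near_eq_differentiable (dF u Uu); apply: near_eq_in Uu.
split=> [u Uu|a].
  by apply: near_eq_differentiable (dF u Uu); apply: near_eq_in Uu.
by apply: IH (CF a) => u; rewrite inE => Uu; exact: pderiv_eq oU FG Uu.
Qed.

Lemma Ck_cst {E : normedModType R} k U (c : E) : Ck k U (cst c).
Proof.
have dc (c' : E) u : differentiable (cst c' : 'rV[R]_m -> E) u.
  exact: differentiable_cst.
elim: k c => [|k IH] c; first by split=> // u _; exact: dc.
split=> [u _|a]; first exact: dc.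
by rewrite (_ : pderiv a _ = cst 0) //; apply/funext => u; exact: derive_cst.
Qed.

Lemma CkD {E : normedModType R} k U (F G : 'rV[R]_m -> E) :
  open U -> Ck k U F -> Ck k U G -> Ck k U (F + G).
Proof.
move=> oU; elim: k F G => [|k IH] F G [dF CF] [dG CG].
  by split; last by []; move=> u Uu; apply: differentiableD; [exact: dF|exact: dG].
split=> [u Uu|a]; first by apply: differentiableD; [exact: dF|exact: dG].
apply: Ck_eq oU _ (IH _ _ (CF a) (CG a)) => u; rewrite inE => Uu.
by rewrite /pderiv deriveD //; apply: diff_derivable; [exact: dF|exact: dG].
Qed.

(** The Leibniz rule leaves one factor undifferentiated in each term; [CkW] lowers its order to fit
    the induction. *)
Lemma CkM k U (F G : 'rV[R]_m -> R^o) :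
  open U -> Ck k U F -> Ck k U G -> Ck k U (F * G : 'rV[R]_m -> R^o).
Proof.
move=> oU; elim: k F G => [|k IH] F G CF CG;
  have [dF CFa] := CF; have [dG CGa] := CG.
  by split; last by []; move=> u Uu; apply: differentiableM; [exact: dF|exact: dG].
split=> [u Uu|a]; first by apply: differentiableM; [exact: dF|exact: dG].
apply: Ck_eq oU _ (CkD oU (IH _ _ (CkW CF) (CGa a)) (IH _ _ (CkW CG) (CFa a))).
move=> u; rewrite inE => Uu.
by rewrite /pderiv deriveM //; apply: diff_derivable; [exact: dF|exact: dG].
Qed.

Lemma Ck_sum k U n (F : 'I_n -> 'rV[R]_m -> R^o) :
  open U -> (forall i, Ck k U (F i)) -> Ck k U (\sum_i F i).
Proof.
move=> oU CF; elim/big_ind : _ => // [|f g]; last exact: CkD.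
exact: (@Ck_cst _ k U 0).
Qed.

Lemma derive_coord {V : normedModType R} {p n : nat} (F : V -> 'M[R]_(p, n))
    u v i j :
  differentiable F u -> 'D_v (fun z => F z i j : R^o) u = 'D_v F u i j.
Proof. by move=> dF; rewrite derive_mx ?mxE //; exact: diff_derivable. Qed.

Lemma Ck_coord {p n : nat} k U (F : 'rV[R]_m -> 'M[R]_(p, n)) i j :
  open U -> Ck k U F -> Ck k U (fun u => F u i j : R^o).
Proof.
have dL (G : 'rV[R]_m -> 'M[R]_(p, n)) u :
    differentiable G u -> differentiable (fun u => G u i j : R^o) u.
  move=> dG; apply: (@differentiable_comp _ _ _ _ G (fun A => A i j : R^o)) => //.
  exact: differentiable_coord.
move=> oU; elim: k F => [|k IH] F [dF CF].
  by split; last by []; move=> u Uu; apply/dL/dF.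
split=> [u Uu|a]; first exact/dL/dF.
apply: Ck_eq oU _ (IH _ (CF a)) => u; rewrite inE => Uu.
by rewrite /pderiv derive_coord //; exact: dF.
Qed.

End Ck.

(** * The chain rule for differentials, Hessians and Laplacians *)

Section ChainRule.
Context {R : realType}.

Lemma diff_sum_pderiv {m : nat} {E : normedModType R} (F : 'rV[R]_m -> E) u v :
  differentiable F u -> 'd F u v = \sum_a v 0 a *: pderiv a F u.
Proof.
move=> dF; rewrite {1}[v]row_sum_delta linear_sum /=; apply: eq_bigr => a _.
by rewrite linearZ /= /pderiv deriveE.
Qed.

Lemma pderiv_comp {m p : nat} (F : 'rV[R]_m -> 'rV[R]_p) (P : 'rV[R]_p -> R^o) u a :
  differentiable F u -> differentiable P (F u) ->
  pderiv a (P \o F) u = \sum_c pderiv a F u 0 c * pderiv c P (F u).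
Proof.
move=> dF dP; rewrite {1}/pderiv deriveE; last exact: differentiable_comp.
rewrite diff_comp //= diff_sum_pderiv //.
by apply: eq_bigr => c _; rewrite /pderiv (deriveE _ dF).
Qed.

(** The derivative of [P \o F] is a sum of products of components of [pderiv a F] with
    [pderiv c P \o F], and the latter falls under the induction hypothesis because [P] is
    generalized. *)
Lemma Ck_comp {m p : nat} k (U : set 'rV[R]_m) (O : set 'rV[R]_p)
    (F : 'rV[R]_m -> 'rV[R]_p) (P : 'rV[R]_p -> R^o) :
  open U -> (forall u, U u -> O (F u)) -> Ck k U F -> Ck k O P -> Ck k U (P \o F).
Proof.
move=> oU FO CF; elim: k P CF => [|k IH] P CF CP.
  split; last by [].
  move=> u Uu; apply: differentiable_comp; first exact: Ck_differentiable CF Uu.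
  by apply: Ck_differentiable CP _; exact: FO.
have dF u : U u -> differentiable F u by exact: Ck_differentiable CF.
have dP u : U u -> differentiable P (F u).
  by move=> Uu; apply: Ck_differentiable CP _; exact: FO.
split=> [u Uu|a]; first by apply: differentiable_comp; [exact: dF|exact: dP].
have CPF c : Ck k U (fun u => (pderiv a F u 0 c * pderiv c P (F u)) : R^o).
  apply: CkM => //; first by apply: Ck_coord => //; have [_] := CF; apply.
  by apply: (IH (pderiv c P)); [exact: CkW|have [_] := CP; apply].
apply: Ck_eq oU _ (Ck_sum oU CPF) => u; rewrite inE => Uu.
by rewrite fct_sumE pderiv_comp //; [exact: dF|exact: dP].
Qed.

Lemma smooth_comp {m p : nat} (U : set 'rV[R]_m) (O : set 'rV[R]_p)
    (F : 'rV[R]_m -> 'rV[R]_p) (P : 'rV[R]_p -> R^o) :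
  open U -> (forall u, U u -> O (F u)) -> smooth_on U F -> smooth_on O P ->
  smooth_on U (P \o F).
Proof.
move=> oU FO /smooth_onP CF /smooth_onP CP; apply/smooth_onP => k.
exact: Ck_comp (CF k) (CP k).
Qed.

Lemma smooth_eq {m : nat} {E : normedModType R} (U : set 'rV[R]_m)
    (F G : 'rV[R]_m -> E) :
  open U -> {in U, F =1 G} -> smooth_on U F -> smooth_on U G.
Proof.
by move=> oU FG /smooth_onP CF; apply/smooth_onP => k; apply: Ck_eq (CF k).
Qed.

Lemma hessian_eq {m : nat} {E : normedModType R} (G : 'rV[R]_m -> 'M[R]_m)
    (U : set 'rV[R]_m) (F F' : 'rV[R]_m -> E) u a b :
  open U -> {in U, F =1 F'} -> U u -> hessian G F u a b = hessian G F' u a b.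
Proof.
move=> oU FF' Uu; rewrite /hessian.
have E1 k : {in U, pderiv k F =1 pderiv k F'}.
  by move=> v; rewrite inE => Uv; exact: (pderiv_eq _ oU FF' Uv).
rewrite (pderiv_eq _ oU (E1 b) Uu); congr (_ + - _).
by apply: eq_bigr => k _; rewrite E1 // inE.
Qed.

Lemma differential_eq {m : nat} {E : normedModType R}
    (U : set 'rV[R]_m) (F F' : 'rV[R]_m -> E) u v :
  open U -> {in U, F =1 F'} -> U u -> differentiable F u -> 'd F u v = 'd F' u v.
Proof.
move=> oU FF' Uu dF; have FF'u := near_eq_in oU FF' Uu.
rewrite -!deriveE //; first exact: near_eq_derive.
exact: near_eq_differentiable FF'u dF.
Qed.

(** [second_fundamental_form] with the charts stripped off: the two are convertible when [F] is a
    local representative and [G], [H] are the metric components. *)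
Definition map_hessian {m p : nat}
    (G : 'rV[R]_m -> 'M[R]_m) (H : 'rV[R]_p -> 'M[R]_p)
    (F : 'rV[R]_m -> 'rV[R]_p) (u : 'rV[R]_m) (a b : 'I_m) : 'rV[R]_p :=
  hessian G F u a b +
  \row_c \sum_(d < p) \sum_(e < p)
    christoffel H (F u) d e c * pderiv a F u 0 d * pderiv b F u 0 e.

Definition hessian_mx {m : nat} (G : 'rV[R]_m -> 'M[R]_m)
  (P : 'rV[R]_m -> R^o) (u : 'rV[R]_m) : 'M[R]_m :=
  \matrix_(a, b) hessian G P u a b.

Lemma pderiv2_comp {m p : nat} (U : set 'rV[R]_m) (O : set 'rV[R]_p)
    (F : 'rV[R]_m -> 'rV[R]_p) (P : 'rV[R]_p -> R^o) u a b :
  open U -> (forall u, U u -> O (F u)) -> Ck 1 U F -> Ck 1 O P -> U u ->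
  pderiv a (pderiv b (P \o F)) u =
    \sum_c (pderiv a (pderiv b F) u 0 c * pderiv c P (F u) +
      \sum_d pderiv a F u 0 d * pderiv b F u 0 c * pderiv d (pderiv c P) (F u)).
Proof.
move=> oU FO CF CP Uu.
have dF v : U v -> differentiable F v by exact: Ck_differentiable CF.
have dP v : U v -> differentiable P (F v).
  by move=> Uv; apply: Ck_differentiable CP _; exact: FO.
have dFa c v : U v -> differentiable (pderiv c F) v.
  by move=> Uv; have [_ /(_ c)[+ _]] := CF; apply.
have dPa c v : U v -> differentiable (pderiv c P) (F v).
  by move=> Uv; have [_ /(_ c)[+ _]] := CP; apply; exact: FO.
pose g c : 'rV[R]_m -> R^o := fun v => pderiv b F v 0 c.
pose q c : 'rV[R]_m -> R^o := pderiv c P \o F.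
rewrite (@pderiv_eq _ _ _ a U _ (\sum_c (g c * q c))) //; last first.
  move=> v; rewrite inE => Uv.
  by rewrite pderiv_comp ?fct_sumE //; [exact: dF|exact: dP].
have dg c : differentiable (g c) u.
  have Cb : Ck 0 U (pderiv b F) by have [_] := CF; apply.
  by have [h _] := Ck_coord 0 c oU Cb; exact: h.
have dq c : differentiable (q c) u.
  by apply: differentiable_comp; [exact: dF|exact: dPa].
rewrite {1}/pderiv derive_sum; last first.
  by move=> c; apply: derivableM; exact: diff_derivable.
apply: eq_bigr => c _; rewrite deriveM;
  [|exact: diff_derivable|exact: diff_derivable].
rewrite addrC; congr (_ + _).
  by rewrite (derive_coord _ _ _ (dFa b u Uu)) mulrC.
rewrite -/(pderiv a (q c) u) pderiv_comp //; [|exact: dF|exact: dPa].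
rewrite scaler_sumr; apply: eq_bigr => d _.
by rewrite /g /GRing.scale /= mulrCA mulrA.
Qed.

(** The Christoffel symbols of the target enter [map_hessian] with a plus sign and [hessian H P]
    with a minus sign, and cancel. *)
Lemma hessian_comp {m p : nat} (G : 'rV[R]_m -> 'M[R]_m) (H : 'rV[R]_p -> 'M[R]_p)
    (U : set 'rV[R]_m) (O : set 'rV[R]_p)
    (F : 'rV[R]_m -> 'rV[R]_p) (P : 'rV[R]_p -> R^o) u a b :
  open U -> (forall u, U u -> O (F u)) -> Ck 1 U F -> Ck 1 O P -> U u ->
  hessian G (P \o F) u a b =
    'd P (F u) (map_hessian G H F u a b) +
    \sum_d \sum_e pderiv a F u 0 d * pderiv b F u 0 e * hessian H P (F u) d e.
Proof.
move=> oU FO CF CP Uu.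
have dF := Ck_differentiable CF Uu.
have dP := Ck_differentiable CP (FO _ Uu).
rewrite {1}/hessian (pderiv2_comp _ _ oU FO CF CP Uu) diff_sum_pderiv //.
rewrite (eq_bigr (fun k => \sum_c christoffel G u a b k * pderiv k F u 0 c *
  pderiv c P (F u))); last first.
  move=> k _; rewrite pderiv_comp // scaler_sumr; apply: eq_bigr => c _.
  by rewrite -mulrA.
rewrite exchange_big /= -sumrB.
(* The sums are reordered with [c] outermost, so that the coefficients of [pderiv c P (F u)] can be
   compared one by one. *)
have -> : \sum_d \sum_e pderiv a F u 0 d * pderiv b F u 0 e * hessian H P (F u) d e =
  \sum_c (\sum_d pderiv a F u 0 d * pderiv b F u 0 c * pderiv d (pderiv c P) (F u) -
    \sum_d \sum_e christoffel H (F u) d e c * pderiv a F u 0 d * pderiv b F u 0 e *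
       pderiv c P (F u)).
  rewrite sumrB [X in _ = X - _]exchange_big [X in _ = _ - X]exchange_big /= -sumrB.
  apply: eq_bigr => d _; rewrite [X in _ = _ - X]exchange_big /= -sumrB.
  apply: eq_bigr => e _; rewrite /hessian mulrBr; congr (_ - _).
  by rewrite mulr_sumr; apply: eq_bigr => c _; rewrite /GRing.scale /=; ring.
rewrite -big_split; apply: eq_bigr => c _ /=.
rewrite /map_hessian /hessian !mxE summxE /GRing.scale /=.
rewrite !mulrDl mulNr !mulr_suml.
under [X in _ = _ - X + _ + _]eq_bigr do rewrite !mxE.
under [X in _ = _ + X + _]eq_bigr do rewrite mulr_suml.
by rewrite [X in _ = _ + X]addrC addrA addrK addrAC.
Qed.

Lemma pderiv_jacobian {m p : nat} (F : 'rV[R]_m -> 'rV[R]_p) u a c :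
  differentiable F u -> pderiv a F u 0 c = ('J F u) a c.
Proof. by move=> dF; rewrite /pderiv deriveEjacobian // -rowE mxE. Qed.

(** Contraction with the inverse metric becomes a trace, since the trace of [X^T *m Y] is the sum of
    all [X a b * Y a b]. *)
Lemma laplacian_comp {m p : nat} (G : 'rV[R]_m -> 'M[R]_m) (H : 'rV[R]_p -> 'M[R]_p)
    (U : set 'rV[R]_m) (O : set 'rV[R]_p)
    (F : 'rV[R]_m -> 'rV[R]_p) (P : 'rV[R]_p -> R^o) u :
  open U -> (forall u, U u -> O (F u)) -> Ck 1 U F -> Ck 1 O P -> U u ->
  trace_form (G u) (hessian G (P \o F) u) =
    'd P (F u) (trace_form (G u) (map_hessian G H F u)) +
    \tr ((invmx (G u))^T *m ('J F u *m hessian_mx H P (F u) *m ('J F u)^T)).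
Proof.
move=> oU FO CF CP Uu; have dF := Ck_differentiable CF Uu.
have -> : \tr ((invmx (G u))^T *m ('J F u *m hessian_mx H P (F u) *m ('J F u)^T)) =
    \sum_a \sum_b invmx (G u) a b *
      \sum_d \sum_e pderiv a F u 0 d * pderiv b F u 0 e * hessian H P (F u) d e.
  have := fun a c => pderiv_jacobian a c dF; move: ('J F u) => J pJ.
  rewrite /mxtrace exchange_big; apply: eq_bigr => b _ /=.
  rewrite mxE; apply: eq_bigr => a _; rewrite mxE; congr (_ * _).
  rewrite mxE exchange_big; apply: eq_bigr => e _ /=.
  rewrite !mxE mulr_suml; apply: eq_bigr => d _.
  by rewrite (pJ a d) (pJ b e) !mxE mulrAC.
rewrite /trace_form linear_sum -big_split; apply: eq_bigr => a _ /=.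
rewrite linear_sum -big_split; apply: eq_bigr => b _ /=.
by rewrite linearZ (hessian_comp G H a b oU FO CF CP Uu) scalerDr.
Qed.

End ChainRule.

(** * Linear algebra of a complex structure *)

Section ComplexStructure.
Context {R : realFieldType} {n : nat} (J : 'M[R]_n).
Hypothesis JJ : J *m J = - 1%:M.
Implicit Types P B D : 'M[R]_n.

(** The product [P J B J] equals [P B] because [B] anticommutes with [J]; by cyclicity its trace is
    [- \tr (P B)] because [P] commutes with [J]. *)
Lemma mxtrace_anticomm P B :
  P *m J = J *m P -> B *m J = - (J *m B) -> \tr (P *m B) = 0.
Proof.
move=> PJ BJ.
have E1 : P *m J *m (B *m J) = P *m B.
  by rewrite BJ mulmxN -mulmxA [J *m (J *m B)]mulmxA JJ mulNmx mul1mx mulmxN opprK.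
have E2 : \tr (P *m J *m (B *m J)) = - \tr (P *m B).
  rewrite mulmxA mxtrace_mulC !mulmxA -PJ -(mulmxA P) JJ mulmxN mulmx1 mulNmx.
  exact: linearN.
by move: E2; rewrite E1; lra.
Qed.

Hypothesis JT : J^T = - J.

Lemma mxtrace_tr_eq0 B : \tr (B *m B^T) = 0 -> B = 0.
Proof.
move=> /eqP; rewrite /mxtrace psumr_eq0 => [/allP H|i _]; last first.
  by rewrite mxE sumr_ge0 // => j _; rewrite mxE -expr2 sqr_ge0.
apply/matrixP => i j; have := H i (mem_index_enum _); rewrite /= mxE.
rewrite psumr_eq0 => [/allP /(_ j (mem_index_enum _))|k _]; last first.
  by rewrite mxE -expr2 sqr_ge0.
by rewrite /= !mxE -expr2 sqrf_eq0 => /eqP.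
Qed.

(** The test matrix [B := P + J P J] is twice the part of [P] that anticommutes with [J], and [J B]
    is the commutator of [J] and [P]. *)
Lemma comm_of_mxtrace_anticomm P : P^T = P ->
  (forall B, B^T = B -> B *m J = - (J *m B) -> \tr (P *m B) = 0) ->
  P *m J = J *m P.
Proof.
move=> PT trP; pose B := P + J *m P *m J.
have BT : B^T = B.
  by rewrite linearD /= !trmx_mul JT PT mulmxN mulNmx mulmxN opprK mulmxA.
have JB : J *m B = J *m P - P *m J by rewrite mulmxDr !mulmxA JJ !mulNmx mul1mx.
have BJ : B *m J = - (J *m B).
  by rewrite JB opprB mulmxDl -[_ *m J *m J]mulmxA JJ mulmxN mulmx1.
suff B0 : B = 0 by apply/esym/eqP; rewrite -subr_eq0 -JB B0 mulmx0.
apply: mxtrace_tr_eq0; rewrite BT {1}/B mulmxDl linearD /= trP // add0r.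
(* This moves the two factors [J] of the second summand of [B] onto the other factor: [\tr (J P J B)
   = \tr (P J B J) = \tr (P B)]. *)
have JBJ : J *m B *m J = B.
  by rewrite -mulmxA BJ mulmxN mulmxA JJ mulNmx mul1mx opprK.
by rewrite -(mulmxA _ J) -mulmxA mxtrace_mulC -mulmxA JBJ trP.
Qed.

(* With [D a b c] standing for [d_a g_bc], this is twice the matrix, for fixed
   [b], of the Christoffel symbols of the first kind. *)
Definition first_kind_mx (D : 'I_n -> 'M[R]_n) b : 'M[R]_n :=
  D b + \matrix_(a, l) D a b l - (\matrix_(a, l) D a b l)^T.

(** Closedness reads [M J + J M^T = J D_b], and multiplying by [J] on both sides gives
    [J M + M^T J = J D_b]. Subtracting shows that [M - M^T] commutes with [J], as [D_b] does. *)
Lemma first_kind_mx_comm (D : 'I_n -> 'M[R]_n) b :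
  (forall a, (D a)^T = D a) -> (forall a, J *m D a = D a *m J) ->
  (forall a b c, (J *m D a) b c + (J *m D b) c a + (J *m D c) a b = 0) ->
  J *m first_kind_mx D b = first_kind_mx D b *m J.
Proof.
move=> DT JD closedD; rewrite /first_kind_mx; set M := \matrix_(_, _) _.
have DTE a k l : D a k l = D a l k by rewrite -[in LHS]DT mxE.
have E : M *m J + J *m M^T = J *m D b.
  apply/matrixP => a c; rewrite -[J *m D b]opprK.
  (* [J D_b] is skew, which brings the term of [closedD] with indices [c a] to the order [a c]. *)
  have -> : - (J *m D b) = (J *m D b)^T by rewrite trmx_mul DT JT mulmxN JD.
  apply/eqP; rewrite -subr_eq0 !mxE opprK; apply/eqP.
  rewrite -[RHS](closedD a b c) (JD a) !mxE addrAC; congr (_ + _ + _).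
    by apply: eq_bigr => k _; rewrite !mxE.
  by apply: eq_bigr => k _; rewrite !mxE DTE.
have E' : J *m M + M^T *m J = J *m D b.
  have : J *m (M *m J + J *m M^T) *m J = J *m (J *m D b) *m J by rewrite E.
  rewrite mulmxDr mulmxDl !mulmxA JJ !mulNmx !mul1mx -!mulmxA JJ !mulmxN !mulmx1.
  by rewrite JD -opprD => /oppr_inj.
rewrite mulmxBr mulmxBl mulmxDr mulmxDl -JD -!addrA; congr (_ + _).
by apply/eqP; rewrite subr_eq addrAC eq_sym subr_eq E E'.
Qed.

End ComplexStructure.

(** * Hessians of functions related by the Cauchy-Riemann equations *)

Section HolomorphicHessian.
Context {R : realType}.

Lemma JmxJmx n : Jmx R n *m Jmx R n = - 1%:M.
Proof.
rewrite /Jmx mulmx_block !mul0mx !mulmx0 !mulmx1 !mul1mx !add0r !addr0.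
by rewrite scalar_mx_block opp_block_mx !oppr0.
Qed.

Lemma trmx_Jmx n : (Jmx R n)^T = - Jmx R n.
Proof.
by rewrite /Jmx tr_block_mx opp_block_mx !trmx0 linearN /= trmx1 !oppr0 opprK.
Qed.

Lemma posdef_unitmx n (H : 'M[R]_n) :
  (forall v : 'rV[R]_n, v != 0 -> 0 < (v *m H *m v^T) 0 0) -> H \in unitmx.
Proof.
move=> Hpos; rewrite unitmxE unitfE; apply/negP => /det0P [v v0 vH].
by have := Hpos v v0; rewrite vH mul0mx mxE ltxx.
Qed.

Section ConstantFactor.
Context {m p q r : nat} (A : 'M[R]_(p, q)).
Context (F : 'rV[R]_m -> 'M[R]_(q, r)) (u : 'rV[R]_m).
Hypothesis dF : differentiable F u.

Let mulmx_coordE i j : (fun z => (A *m F z) i j : R^o) =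
  \sum_k (A i k \*: (fun z => F z k j : R^o)).
Proof. by apply/funext => z; rewrite mxE fct_sumE. Qed.

Let derivable_coord v i j : derivable (fun z => F z i j : R^o) u v.
Proof.
by move/(@diff_derivable _ _ _ _ _ v)/derivable_mxP : dF; apply.
Qed.

Lemma derivable_mulmx v : derivable (fun z => A *m F z) u v.
Proof.
apply/derivable_mxP => i j; rewrite mulmx_coordE; apply: derivable_sum => k.
exact: derivableZ.
Qed.

Lemma pderiv_mulmx a : pderiv a (fun z => A *m F z) u = A *m pderiv a F u.
Proof.
rewrite /pderiv derive_mx; last exact: derivable_mulmx.
apply/matrixP => i j; rewrite !mxE mulmx_coordE derive_sum => [|k]; last first.
  exact: derivableZ.
by apply: eq_bigr => k _; rewrite deriveZ // derive_coord.
Qed.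

End ConstantFactor.

(** The endomorphism sending [v] to the covariant derivative along [v] of the coordinate field [b],
    acting on row vectors. *)
Definition christoffel_mx {m : nat} (G : 'rV[R]_m -> 'M[R]_m) u b : 'M[R]_m :=
  \matrix_(a, k) christoffel G u a b k.

Section Hessian.
Context {m : nat} (G : 'rV[R]_m -> 'M[R]_m) (O : set 'rV[R]_m) (u : 'rV[R]_m).
Hypotheses (oO : open O) (Ou : O u).
Implicit Types p q : 'rV[R]_m -> R^o.

Lemma pderiv_swap p a b : Ck 1 O p ->
  pderiv a (pderiv b p) u = pderiv b (pderiv a p) u.
Proof.
move=> Cp; apply: derive_swap.
- near=> z; apply: (Ck_differentiable Cp).
  by near: z; apply: open_nbhs_nbhs.
- by have [_ /(_ b)[+ _]] := Cp; apply.
- by have [_ /(_ a)[+ _]] := Cp; apply.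
Unshelve. all: by end_near. Qed.

Lemma trmx_hessian_mx p :
  (forall a b k, christoffel G u a b k = christoffel G u b a k) ->
  Ck 1 O p -> (hessian_mx G p u)^T = hessian_mx G p u.
Proof.
move=> sG Cp; apply/matrixP => a b; rewrite !mxE /hessian pderiv_swap //.
by congr (_ + - _); apply: eq_bigr => k _; rewrite sG.
Qed.

(** The second-order terms come from differentiating the Cauchy-Riemann equations along [b]. In the
    Christoffel terms, commutation moves [J] from the free index to the summed one, where these
    equations apply again. *)
Lemma mul_hessian_mx (J : 'M[R]_m) p q :
  (forall b, J *m christoffel_mx G u b = christoffel_mx G u b *m J) ->
  Ck 1 O p -> Ck 1 O q ->
  (forall z a, O z -> \sum_c J a c * pderiv c p z = - pderiv a q z) ->
  J *m hessian_mx G p u = - hessian_mx G q u.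
Proof.
move=> JG Cp Cq CR; apply/matrixP => a b; rewrite !mxE.
have dp c : differentiable (pderiv c p) u by have [_ /(_ c)[+ _]] := Cp; apply.
(* Swapping derivatives puts the index contracted with [J] innermost; the Cauchy-Riemann equations
   hold on all of [O] and so may be differentiated. *)
have E1 : \sum_c J a c * pderiv c (pderiv b p) u = - pderiv a (pderiv b q) u.
  rewrite [pderiv a _ u]pderiv_swap // -[RHS]deriveN; last first.
    by apply: diff_derivable; have [_ /(_ a)[+ _]] := Cq; apply.
  rewrite -[RHS](@pderiv_eq _ _ _ b O (\sum_c (J a c \*: (pderiv c p)))) //;
    last first.
    by move=> z; rewrite inE => Oz; rewrite fct_sumE; exact: CR.
  rewrite /pderiv derive_sum => [|c]; last by apply/derivableZ/diff_derivable/dp.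
  apply: eq_bigr => c _; rewrite deriveZ; last by apply/diff_derivable/dp.
  by rewrite -/(pderiv c (pderiv b p) u) pderiv_swap.
have E2 k : \sum_c J a c * christoffel G u c b k =
            \sum_c christoffel G u a b c * J c k.
  have /matrixP/(_ a k) := JG b; rewrite !mxE.
  by under eq_bigr do rewrite mxE; under [RHS]eq_bigr do rewrite mxE.
under eq_bigr do rewrite mxE /hessian mulrBr mulr_sumr.
rewrite sumrB E1 exchange_big /= /hessian opprB addrC; congr (_ + _).
rewrite -sumrN (eq_bigr (fun k =>
  - \sum_c christoffel G u a b c * J c k * pderiv k p u)).
  rewrite sumrN exchange_big /= -sumrN; apply: eq_bigr => c _.
  under eq_bigr do rewrite -mulrA.
  by rewrite -mulr_sumr CR // mulrN opprK.
move=> k _; rewrite -mulr_suml -E2 mulr_suml; congr (- _).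
by apply: eq_bigr => c _; rewrite mulrA.
Qed.

End Hessian.

(** * Christoffel symbols of a Kähler metric *)

Section Metric.
Context {m : nat} (G : 'rV[R]_m -> 'M[R]_m) (O : set 'rV[R]_m) (u : 'rV[R]_m).
Hypotheses (oO : open O) (Ou : O u) (dG : differentiable G u).
Hypothesis sG : forall z, O z -> (G z)^T = G z.

Lemma trmx_pderiv a : (pderiv a G u)^T = pderiv a G u.
Proof.
apply/matrixP => b c; rewrite mxE /pderiv -!derive_coord //.
apply: near_eq_derive; apply: near_eq_in Ou => // z; rewrite inE => Oz.
by rewrite -[in LHS]sG // mxE.
Qed.

Lemma christoffel_sym a b k : christoffel G u a b k = christoffel G u b a k.
Proof.
rewrite /christoffel; congr (_ * _); apply: eq_bigr => l _; congr (_ * (_ - _)).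
  by rewrite addrC.
by rewrite -[in LHS]trmx_pderiv mxE.
Qed.

Variable J : 'M[R]_m.
Hypotheses (JJ : J *m J = - 1%:M) (JT : J^T = - J).
Hypothesis hermG : forall z, O z -> J *m G z *m J^T = G z.

Lemma hermitian_comm z : O z -> J *m G z = G z *m J.
Proof.
move=> Oz; rewrite -[in RHS](hermG Oz) JT mulmxN mulNmx -mulmxA JJ.
by rewrite mulmxN mulmx1 opprK.
Qed.

(** For symmetric matrices, commuting with [J] means that the product with [J] is skew, a linear
    condition on entries that passes to derivatives. *)
Lemma pderiv_hermitian_comm a : J *m pderiv a G u = pderiv a G u *m J.
Proof.
have skew z : O z -> (J *m G z)^T = - (J *m G z).
  by move=> Oz; rewrite trmx_mul sG // JT mulmxN hermitian_comm.
suff : (J *m pderiv a G u)^T = - (J *m pderiv a G u).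
  by rewrite trmx_mul trmx_pderiv JT mulmxN => /oppr_inj.
rewrite -pderiv_mulmx // /pderiv derive_mx; last exact: derivable_mulmx.
apply/matrixP => b c; rewrite !mxE -deriveN; last first.
  by have /derivable_mxP := @derivable_mulmx _ _ _ _ J _ _ dG (delta_mx 0 a); apply.
apply: near_eq_derive; apply: near_eq_in Ou => // z; rewrite inE => Oz.
by have /matrixP/(_ b c) := skew z Oz; rewrite mxE [RHS]mxE.
Qed.

Hypothesis closedG : forall a b c,
  pderiv a (fun z => J *m G z) u b c + pderiv b (fun z => J *m G z) u c a +
  pderiv c (fun z => J *m G z) u a b = 0.
Hypothesis uG : G u \in unitmx.

(** Up to the factor 1/2, the matrix is the product of [first_kind_mx] and the inverse metric, and
    both commute with [J]. *)
Lemma kahler_christoffel_comm b :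
  J *m christoffel_mx G u b = christoffel_mx G u b *m J.
Proof.
pose D a : 'M[R]_m := pderiv a G u.
have DTE a k l : D a k l = D a l k.
  by have /matrixP/(_ k l) := trmx_pderiv a; rewrite mxE.
have gE a k : christoffel G u a b k =
    2^-1 * \sum_l invmx (G u) k l * (D a b l + D b a l - D l a b) by [].
have -> : christoffel_mx G u b = 2^-1 *: (first_kind_mx D b *m invmx (G u)).
  rewrite -[invmx (G u)]trmxK trmx_inv sG //.
  clearbody D; apply/matrixP => a k; rewrite mxE gE !mxE; congr (_ * _).
  apply: eq_bigr => l _; rewrite (DTE l) (addrC (D a b l)).
  by rewrite !mxE mulrC.
have JGi : J *m invmx (G u) = invmx (G u) *m J.
  apply: (can_inj (mulKmx uG)); rewrite mulKVmx // mulmxA -hermitian_comm //.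
  by rewrite mulmxK.
rewrite -scalemxAr -scalemxAl -!mulmxA -JGi !mulmxA; congr (_ *: (_ *m _)).
apply: first_kind_mx_comm => //.
- exact: trmx_pderiv.
- exact: pderiv_hermitian_comm.
- move=> a' b' c'; rewrite -[RHS](closedG a' b' c').
  by rewrite (pderiv_mulmx _ dG a') (pderiv_mulmx _ dG b') (pderiv_mulmx _ dG c').
Qed.

End Metric.
End HolomorphicHessian.

(** * Quadratic polynomials as test functions *)

Section Quadratic.
Context {R : realType} {m : nat}.
Implicit Types (S J : 'M[R]_m) (s : 'cV[R]_m) (z v : 'rV[R]_m).

Definition coordinate (a : 'I_m) : 'rV[R]_m -> R^o := fun z => z 0 a.

Let differentiable_id (z : 'rV[R]_m) : differentiable (id : 'rV[R]_m -> 'rV[R]_m) z.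
Proof. exact: ex_diff. Qed.

Lemma Ck_coordinate k U a : open U -> Ck k U (coordinate a).
Proof.
move=> oU; apply: (@Ck_coord _ _ _ _ k U id 0 a oU).
case: k => [|k]; split; first by move=> u _; exact: differentiable_id.
- by [].
- by move=> u _; exact: differentiable_id.
- move=> b; rewrite (_ : pderiv b _ = cst (delta_mx 0 b)); first exact: Ck_cst.
  by apply/funext => u; rewrite /pderiv derive_id.
Qed.

Lemma pderiv_coordinate a c z : pderiv c (coordinate a) z = (a == c)%:R.
Proof.
by rewrite /pderiv (@derive_coord _ _ _ _ id) ?derive_id ?mxE ?eqxx.
Qed.

Definition affine (t : R) (w : 'I_m -> R) : 'rV[R]_m -> R^o :=
  cst (t : R^o) + \sum_b cst (w b : R^o) * coordinate b.

Lemma Ck_affine k U t w : open U -> Ck k U (affine t w).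
Proof.
move=> oU; apply: CkD => //; first exact: Ck_cst.
by apply: Ck_sum => // b; apply: CkM => //; [exact: Ck_cst|exact: Ck_coordinate].
Qed.

Lemma affineE t w z : affine t w z = t + \sum_b w b * z 0 b.
Proof. by rewrite /affine fctE fct_sumE. Qed.

Lemma derivable_coordinate a z v : derivable (coordinate a) z v.
Proof.
apply: diff_derivable; apply: (@Ck_differentiable _ _ _ 0 setT) => //.
exact: Ck_coordinate openT.
Qed.

Lemma derivable_affine t w z v : derivable (affine t w) z v.
Proof.
apply: diff_derivable; apply: (@Ck_differentiable _ _ _ 0 setT) => //.
exact: Ck_affine openT.
Qed.

Lemma pderiv_affine t w c z : pderiv c (affine t w) z = w c.
Proof.
have dX b : derivable (coordinate b) z (delta_mx 0 c) by exact: derivable_coordinate.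
rewrite /pderiv /affine deriveD; last 2 first.
- exact: derivable_cst.
- by apply: derivable_sum => b; apply: derivableM => //; exact: derivable_cst.
rewrite derive_cst add0r derive_sum => [|b]; last first.
  by apply: derivableM => //; exact: derivable_cst.
rewrite (bigD1 c) //= big1 => [|b bc]; rewrite deriveM //; try exact: derivable_cst.
  rewrite -[X in _ *: X + _]/(pderiv c _ z) pderiv_coordinate eqxx derive_cst.
  by rewrite scaler0 !addr0 /GRing.scale /= mulr1.
rewrite -[X in _ *: X + _]/(pderiv c _ z) pderiv_coordinate (negPf bc).
by rewrite derive_cst !scaler0 addr0.
Qed.

(* z |-> (z S z^T) / 2 + z s *)
Definition quadratic S s : 'rV[R]_m -> R^o :=
  \sum_a coordinate a * affine (s a 0) (fun b => 2^-1 * S a b).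

Lemma Ck_quadratic k U S s : open U -> Ck k U (quadratic S s).
Proof.
move=> oU; apply: Ck_sum => // a.
by apply: CkM => //; [exact: Ck_coordinate|exact: Ck_affine].
Qed.

Lemma pderiv_quadratic S s c : S^T = S ->
  pderiv c (quadratic S s) = affine (s c 0) (S c).
Proof.
move=> ST; apply/funext => z; rewrite /pderiv /quadratic.
rewrite derive_sum => [|a]; last first.
  by apply: derivableM; [exact: derivable_coordinate|exact: derivable_affine].
under eq_bigr => a _.
  rewrite deriveM; [|exact: derivable_coordinate|exact: derivable_affine].
  rewrite -![derive _ z _]/(pderiv c _ z) pderiv_affine pderiv_coordinate.
  over.
rewrite big_split /= [X in _ + X](bigD1 c) //= eqxx.
rewrite [X in _ + (_ + X)]big1 => [|a /negPf ->]; last exact: scaler0.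
rewrite addr0 !affineE /GRing.scale /= mulr1 addrCA; congr (_ + _).
rewrite -big_split; apply: eq_bigr => b _ /=.
have -> : S b c = S c b by rewrite -[in LHS]ST mxE.
by rewrite /coordinate; field.
Qed.

Lemma diff_quadratic S s z v : S^T = S ->
  'd (quadratic S s) z v = (v *m (S *m z^T + s)) 0 0.
Proof.
move=> ST; rewrite diff_sum_pderiv; last first.
  by apply: (@Ck_differentiable _ _ _ 0 setT) => //; exact: Ck_quadratic openT.
rewrite mxE; apply: eq_bigr => c _; rewrite pderiv_quadratic // affineE !mxE addrC.
by congr (_ * (_ + _)); apply: eq_bigr => b _; rewrite mxE.
Qed.

(** [S *m z^T + s] is the gradient at [z]; where it vanishes, the Christoffel terms drop out of the
    Hessian. *)
Lemma hessian_mx_quadratic G S s z : S^T = S -> S *m z^T + s = 0 ->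
  hessian_mx G (quadratic S s) z = S.
Proof.
move=> ST /matrixP grad0; apply/matrixP => a b; rewrite mxE /hessian big1 => [|k _].
  by rewrite subr0 pderiv_quadratic // pderiv_affine -[in LHS]ST mxE.
have -> : pderiv k (quadratic S s) z = 0.
  have := grad0 k 0; rewrite !mxE => E0; rewrite pderiv_quadratic // affineE addrC.
  apply: etrans E0; congr (_ + _).
  by apply: eq_bigr => b' _; rewrite mxE.
exact: scaler0.
Qed.

(** The gradient of the conjugate function has to be [- J (S z^T + s)]. Since [S] anticommutes with
    [J], this is [S J z^T - J s] with [S J] symmetric, the gradient of [Q]. *)
Lemma quadratic_cauchy_riemann J S s z v :
  J^T = - J -> J *m J = - 1%:M -> S^T = S -> S *m J = - (J *m S) ->
  let P := quadratic S s in let Q := quadratic (S *m J) (- (J *m s)) in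
  'd P z (v *m J) = - 'd Q z v /\ 'd Q z (v *m J) = 'd P z v.
Proof.
move=> JT JJ ST SJ P Q.
have SJT : (S *m J)^T = S *m J by rewrite trmx_mul JT ST mulNmx SJ.
have dP w : 'd P z w = (w *m (S *m z^T + s)) 0 0 by exact: diff_quadratic.
have dQ w : 'd Q z w = (w *m (S *m J *m z^T - J *m s)) 0 0 by exact: diff_quadratic.
have E : S *m J *m z^T - J *m s = - (J *m (S *m z^T + s)).
  by rewrite SJ mulNmx mulmxDr opprD mulmxA.
split.
  apply: (etrans (dP _)); apply/esym/(etrans (congr1 -%R (dQ _))).
  by rewrite E -mulmxA mulmxN mxE opprK.
apply: (etrans (dQ _)); apply/esym/(etrans (dP _)).
by rewrite E mulmxN -mulmxA [J *m (J *m _)]mulmxA JJ mulNmx mul1mx mulmxN opprK.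
Qed.

End Quadratic.

(** * Composition with a smooth map, in charts *)

Lemma chart_image_open (R : realType) m (M : manifold R m) i (A : set M) :
  open A -> open (chart i @` (dom i `&` A)).
Proof.
move=> oA; rewrite openE => _ [x [ix Ax] <-].
have ci : nbhs (chart i x) (chart i @` dom i).
  by apply: open_nbhs_nbhs; split; [exact: chart_codom_open|exists x].
have pA : nbhs (chart i x) (param i @^-1` A).
  by apply: (param_continuous ix); rewrite chartK //; apply: open_nbhs_nbhs.
rewrite /interior; move: ci pA; apply: filterS2 => _ [x' ix' <-].
by rewrite /preimage /= chartK // => Ax'; exists x'.
Qed.

Section Composition.
Context {R : realType} {m p : nat} (M : manifold R m) (N : manifold R p).
Variables (phi : M -> N) (phi_smooth : smooth_map phi) (W : set N) (oW : open W).

Lemma open_preimage_dom j : open (phi @^-1` (dom j `&` W)).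
Proof.
apply: open_comp => [x _|]; first exact: phi_smooth.1.
by apply: openI => //; exact: dom_open.
Qed.

Let U i (j : chart_index N) := chart i @` (dom i `&` phi @^-1` (dom j `&` W)).

Lemma local_rep_image i j u :
  U i j u -> (chart j @` (dom j `&` W)) (local_rep phi i j u).
Proof.
move=> [x [ix [jx Wx]] <-].
by exists (phi x); rewrite // /local_rep /= chartK.
Qed.

Lemma local_rep_smooth i j : smooth_on (U i j) (local_rep phi i j).
Proof.
move=> s _ [x [ix [jx Wx]] <-]; apply: (phi_smooth.2 i j s).
by exists x.
Qed.

Lemma smooth_function_comp (r : N -> R) :
  smooth_function_on W r -> smooth_function_on (phi @^-1` W) (r \o phi).
Proof.
move=> sr i s _ [x [ix Wx] <-]; have [j jx] := dom_cover (phi x).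
have oU : open (U i j) by apply/chart_image_open/open_preimage_dom.
suff : smooth_on (U i j) ((r \o phi) \o param i : _ -> R^o) by apply; exists x.
apply: (@smooth_eq _ _ _ _ ((r \o param j : _ -> R^o) \o local_rep phi i j)) => //.
  move=> u; rewrite inE => -[x' [ix' [jx' _]] <-].
  by rewrite /local_rep /= chartK // chartK.
exact: smooth_comp oU (@local_rep_image i j) (@local_rep_smooth i j) (sr j).
Qed.

Variables (g : riemannian_metric M) (h : riemannian_metric N) (V : vector_field M).

(** [P] is kept apart from [r \o param j], with which it agrees over [W], so that a polynomial in
    the coordinates can serve directly. *)
Lemma V_laplacian_comp (r : N -> R) (P : 'rV[R]_p -> R^o) i j x :
  dom i x -> dom j (phi x) -> W (phi x) ->
  (forall y, dom j y -> W y -> r y = P (chart j y)) ->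
  Ck 1 (chart j @` (dom j `&` W)) P ->
  let u := chart i x in let A := 'J (local_rep phi i j) u in
  V_laplacian g V (r \o phi) i u =
    'd P (chart j (phi x)) (V_tension g h V phi i j u) +
    \tr (A^T *m invmx (g i u) *m A *m hessian_mx (h j) P (chart j (phi x))).
Proof.
move=> ix jx Wx rP CP u A; set F := local_rep phi i j in A *.
have oU : open (U i j) by apply/chart_image_open/open_preimage_dom.
have Uu : U i j u by exists x.
have CF : Ck 1 (U i j) F by have /smooth_onP := @local_rep_smooth i j; apply.
have E : {in U i j, (r \o phi) \o param i =1 P \o F}.
  move=> _ /set_mem[x' [ix' [jx' Wx']] <-].
  by rewrite /F /local_rep /= chartK // rP.
have Fu : F u = chart j (phi x) by rewrite /F /local_rep /= chartK.
have dF := Ck_differentiable CF Uu.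
have dP := Ck_differentiable CP (local_rep_image Uu).
have oO : open (chart j @` (dom j `&` W)) by exact: chart_image_open.
have gT : (invmx (g i u))^T = invmx (g i u) by rewrite trmx_inv Defs.metric_sym.
rewrite /V_laplacian /V_tension linearD /=.
have -> : trace_form (g i u) (hessian (g i) ((r \o phi) \o param i : _ -> R^o) u) =
          trace_form (g i u) (hessian (g i) (P \o F) u).
  apply: eq_bigr => a _; apply: eq_bigr => b _; congr (_ *: _).
  exact: hessian_eq oU E Uu.
rewrite (laplacian_comp _ (h j) oU (@local_rep_image i j) CF CP Uu).
have -> : 'd ((r \o phi) \o param i : _ -> R^o) u (V i u) =
    'd P (F u) ('d F u (V i u)).
  rewrite -(@differential_eq _ _ _ (U i j) (P \o F)) //; last 2 first.
  - by move=> v /E.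
  - exact: differentiable_comp.
  by rewrite diff_comp.
rewrite -Fu /tension -!addrA; congr (_ + _); rewrite addrC; congr (_ + _).
by rewrite gT !mulmxA mxtrace_mulC !mulmxA.
Qed.

End Composition.

(** * Holomorphic functions on a Kähler manifold *)

Lemma diff_comp_jacobian (R : realType) m p (F : 'rV[R]_m -> 'rV[R]_p)
    (P : 'rV[R]_p -> R^o) u w :
  differentiable F u -> differentiable P (F u) ->
  'd (P \o F) u w = 'd P (F u) (w *m 'J F u).
Proof.
move=> dF dP; rewrite diff_comp //=; congr ('d P _ _).
by rewrite -deriveE // deriveEjacobian.
Qed.

Section Kahler.
Context {R : realType} {n : nat} (N : kahler_manifold R n).
Local Notation h := (kahler_metric N).
Local Notation J := (Jmx R n).

(** The Cauchy-Riemann equations give [J B = - C]. As [B] and [C] are symmetric and [J] is skew,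
    transposing gives [B J = C], hence [B J = - J B]; the claim for [C = - J B] follows. *)
Lemma hessian_mx_anticomm (j : chart_index N) (W : set N)
    (p q : 'rV[R]_(n + n) -> R^o) y :
  open W -> dom j y -> W y ->
  let O := chart j @` (dom j `&` W) in
  Ck 1 O p -> Ck 1 O q ->
  (forall z v, O z -> 'd p z (v *m J) = - 'd q z v) ->
  let B := hessian_mx (h j) p (chart j y) in
  let C := hessian_mx (h j) q (chart j y) in
  B *m J = - (J *m B) /\ C *m J = - (J *m C).
Proof.
move=> oW jy Wy O Cp Cq CR B C.
have oO : open O by exact: chart_image_open.
have Oy : O (chart j y) by exists y.
have sG z : O z -> (h j z)^T = h j z by move=> [x [jx _] <-]; exact: Defs.metric_sym.
have dG : differentiable (h j) (chart j y).
  by apply: (@metric_smooth _ _ _ h j [::] (chart j y)); exists y.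
have hG z : O z -> J *m h j z *m J^T = h j z.
  by move=> [x [jx _] <-]; exact: kahler_hermitian.
have uG : h j (chart j y) \in unitmx by apply: posdef_unitmx; exact: metric_pos.
have JG b := kahler_christoffel_comm oO Oy dG sG (JmxJmx n) (trmx_Jmx n) hG
  (kahler_closed jy) uG b.
have Gs a b k := christoffel_sym oO Oy dG sG a b k.
have JB : J *m B = - C.
  apply: (mul_hessian_mx oO Oy JG Cp Cq) => z a Oz.
  rewrite {2}/pderiv (deriveE _ (Ck_differentiable Cq Oz)) -CR //.
  rewrite -rowE diff_sum_pderiv; last exact: Ck_differentiable Cp Oz.
  by apply: eq_bigr => b _; rewrite [row _ _ _ _]mxE.
have BT : B^T = B by exact: trmx_hessian_mx Gs Cp.
have CT : C^T = C by exact: trmx_hessian_mx Gs Cq.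
have BJ : B *m J = - (J *m B).
  by rewrite JB opprK -CT -[C]opprK -JB linearN /= trmx_mul BT trmx_Jmx mulmxN opprK.
split; first exact: BJ.
have -> : C = - (J *m B) by rewrite JB opprK.
by rewrite mulNmx -mulmxA BJ !mulmxN.
Qed.

(* Multiplying on the left by the metric, which commutes with J, turns
   [A^T g^-1 A] into [d phi o (d phi)^*]. *)
Lemma comm_adjoint_mx m (j : chart_index N) y (G : 'M[R]_m) (A : 'M[R]_(m, n + n)) :
  dom j y ->
  comm_mx (adjoint_mx G (h j (chart j y)) A *m A) J <->
  A^T *m invmx G *m A *m J = J *m (A^T *m invmx G *m A).
Proof.
move=> jy; have uG : h j (chart j y) \in unitmx.
  by apply: posdef_unitmx; exact: metric_pos.
have JH : J *m h j (chart j y) = h j (chart j y) *m J.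
  apply: (@hermitian_comm _ _ (h j) [set chart j y]) => //.
  - exact: JmxJmx.
  - exact: trmx_Jmx.
  - by move=> _ ->; exact: kahler_hermitian.
rewrite /comm_mx /adjoint_mx -!mulmxA [J *m (_ *m _)]mulmxA JH -!mulmxA.
by split => [/(can_inj (mulKmx uG))|->].
Qed.

(** In another chart the function is the polynomial after a transition map, whose Jacobian commutes
    with [J], so the Cauchy-Riemann equations carry over. *)
Lemma holomorphic_quadratic (j : chart_index N) (S : 'M[R]_(n + n)) s :
  S^T = S -> S *m J = - (J *m S) ->
  holomorphic_on (dom j) (fun y : N => Complex (quadratic S s (chart j y))
     (quadratic (S *m J) (- (J *m s)) (chart j y))).
Proof.
move=> ST SJ.
have sq S' s' :
    smooth_function_on (dom j) (fun y : N => quadratic S' s' (chart j y)).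
  move=> i; apply: (@smooth_comp _ _ _ _ setT (chart j \o param i)) => //.
  - by apply: chart_image_open; exact: dom_open.
  - exact: transition_smooth.
  - by apply/smooth_onP => k; apply: Ck_quadratic openT.
split; [exact: sq|exact: sq|].
move=> i x ix jx v.
have dt : differentiable (chart j \o param i) (chart i x).
  by apply: (@transition_smooth _ _ N i j [::] (chart i x)); exists x.
have dq S' s' w :
    'd ((quadratic S' s' : _ -> R^o) \o (chart j \o param i)) (chart i x) w =
    'd (quadratic S' s') (chart j (param i (chart i x))) (w *m transition_jac i j x).
  have dq' z : differentiable (quadratic S' s') z.
    by apply: (Ck_differentiable (Ck_quadratic 0 S' s' openT)).
  exact: diff_comp_jacobian dt (dq' _).
have [CR1 CR2] := @quadratic_cauchy_riemann R _ J S s (chart j (param i (chart i x)))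
  (v *m transition_jac i j x) (trmx_Jmx n) (JmxJmx n) ST SJ.
have TJ : v *m J *m transition_jac i j x = v *m transition_jac i j x *m J.
  by rewrite -!mulmxA (cm_transition ix jx).
have mulI c d : 'i%C * Complex c d = Complex (- d) c :> R[i].
  by rewrite /GRing.mul /= !mul0r !mul1r sub0r add0r.
rewrite /cdiff mulI; congr Complex.
  by apply: (etrans (dq S s (v *m J))); apply/esym/(etrans (congr1 -%R (dq _ _ v)));
     rewrite -CR1 TJ.
by apply: (etrans (dq _ _ (v *m J))); apply/esym/(etrans (dq S s v)); rewrite TJ.
Qed.

End Kahler.

(** * The two implications *)

Section Characterization.
Context {R : realType} {m n : nat} (M : manifold R m) (g : riemannian_metric M).
Variables (N : kahler_manifold R n) (V : vector_field M) (phi : M -> N).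
Hypothesis phi_smooth : smooth_map phi.
Local Notation h := (kahler_metric N).
Local Notation J := (Jmx R n).

(** Handles one real function at a time, for use on real and imaginary parts: V-harmonicity kills
    the differential term and PHWC the trace term of [V_laplacian_comp]. *)
Lemma V_PHM_comp_harmonic (W : set N) (r : N -> R) :
  V_pseudo_harmonic_morphism g V phi -> open W -> smooth_function_on W r ->
  (forall j y, dom j y -> W y ->
    let B := hessian_mx (h j) (r \o param j : _ -> R^o) (chart j y) in
    B *m J = - (J *m B)) ->
  real_V_harmonic_on g V (phi @^-1` W) (r \o phi).
Proof.
move=> [harm phwc] oW sr BJ; split; first exact: smooth_function_comp.
move=> i x ix Wx; have [j jx] := dom_cover (phi x).
rewrite (@V_laplacian_comp _ _ _ _ _ phi phi_smooth W oW g h V r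
  (r \o param j : _ -> R^o) i j) //.
- rewrite (harm i j x ix jx) linear0 add0r; apply: (mxtrace_anticomm (JmxJmx n)).
    exact: (comm_adjoint_mx _ _ jx).1 (phwc i j x ix jx).
  exact: BJ.
- by move=> y jy _; rewrite /= chartK.
- by have /smooth_onP := sr j; apply.
Qed.

Lemma V_PHM_pullback (W : set N) (f : N -> R[i]) :
  V_pseudo_harmonic_morphism g V phi -> open W -> holomorphic_on W f ->
  V_harmonic_on g V (phi @^-1` W) (f \o phi).
Proof.
move=> phm oW [sRe sIm CR].
have anti j y : dom j y -> W y ->
    let p := (@complex.Re R \o f) \o param j : _ -> R^o in
    let q := (@complex.Im R \o f) \o param j : _ -> R^o in
    let B := hessian_mx (h j) p (chart j y) in
    let C := hessian_mx (h j) q (chart j y) in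
    B *m J = - (J *m B) /\ C *m J = - (J *m C).
  move=> jy Wy p q; apply: (hessian_mx_anticomm oW jy Wy).
  - by have /smooth_onP := sRe j; apply.
  - by have /smooth_onP := sIm j; apply.
  (* The real part of [df (J v) = i df v] is the relation required between [p] and [q]. *)
  - move=> _ v [x [jx Wx] <-]; have := CR j x jx Wx v.
    rewrite /cdiff /GRing.mul /= => -[+ _].
    by rewrite mul0r mul1r sub0r.
split.
  by apply: (@V_PHM_comp_harmonic W (@complex.Re R \o f)) => // j y jy Wy;
     exact: (anti j y jy Wy).1.
by apply: (@V_PHM_comp_harmonic W (@complex.Im R \o f)) => // j y jy Wy;
   exact: (anti j y jy Wy).2.
Qed.

Hypothesis pullback : forall (W : set N) (f : N -> R[i]),
  open W -> phi @^-1` W !=set0 -> holomorphic_on W f ->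
  V_harmonic_on g V (phi @^-1` W) (f \o phi).

(** The hypothesis is applied with [W := dom j], whose preimage contains [x], and the equation for
    the real part is expanded at [x]. *)
Lemma pullback_quadratic i j x (S : 'M[R]_(n + n)) s :
  dom i x -> dom j (phi x) -> S^T = S -> S *m J = - (J *m S) ->
  let u := chart i x in let A := 'J (local_rep phi i j) u in
  'd (quadratic S s) (chart j (phi x)) (V_tension g h V phi i j u) +
  \tr (A^T *m invmx (g i u) *m A *m
    hessian_mx (h j) (quadratic S s) (chart j (phi x))) = 0.
Proof.
move=> ix jx ST SJ u A.
have oj : open (dom j) by exact: dom_open.
have ne : phi @^-1` dom j !=set0 by exists x.
have [[_ harm] _] := pullback oj ne (holomorphic_quadratic j s ST SJ).
have CP : Ck 1 (chart j @` (dom j `&` dom j)) (quadratic S s).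
  exact/Ck_quadratic/chart_image_open.
have := @V_laplacian_comp _ _ _ _ _ phi phi_smooth (dom j) oj g h V
  (fun y => quadratic S s (chart j y)) (quadratic S s) i j x ix jx jx
  (fun _ _ _ => erefl) CP.
by move=> E; exact: etrans (esym E) (harm i x ix jx).
Qed.

Lemma V_PHM_of_pullback : V_pseudo_harmonic_morphism g V phi.
Proof.
have comm i j x : dom i x -> dom j (phi x) ->
    let u := chart i x in let A := 'J (local_rep phi i j) u in
    A^T *m invmx (g i u) *m A *m J = J *m (A^T *m invmx (g i u) *m A).
  move=> ix jx u A; apply: (comm_of_mxtrace_anticomm (JmxJmx n) (trmx_Jmx n)).
    by rewrite !trmx_mul trmxK trmx_inv Defs.metric_sym // mulmxA.
  (* This [s] makes the image of [x] a critical point: the tension term disappears and the Hessian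
     is exactly [S]. *)
  move=> S ST SJ; pose s := - (S *m (chart j (phi x))^T).
  have grad0 : S *m (chart j (phi x))^T + s = 0 by rewrite subrr.
  have := pullback_quadratic s ix jx ST SJ.
  by rewrite /= hessian_mx_quadratic // diff_quadratic // grad0 mulmx0 mxE add0r.
split=> [i j x ix jx|i j x ix jx]; last exact/(comm_adjoint_mx _ _ jx)/comm.
have oj : open (dom j) by exact: dom_open.
pose t := V_tension g h V phi i j (chart i x); rewrite -/t.
suff ts (s : 'cV_(n + n)) : (t *m s) 0 0 = 0.
  apply/rowP => c; have := ts (delta_mx c 0).
  by rewrite -colE !mxE.
have S0 : (0 : 'M[R]_(n + n))^T = 0 by exact: trmx0.
have SJ0 : 0 *m J = - (J *m 0) by rewrite mul0mx mulmx0 oppr0.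
have oO : open (chart j @` (dom j `&` dom j)) by exact: chart_image_open.
(* The covariant Hessian of a linear function consists of Christoffel terms and need not vanish, but
   it anticommutes with [J]; by PHWC, just established, its trace term is zero. *)
have [BJ _] := hessian_mx_anticomm oj jx jx (Ck_quadratic 1 0 s oO)
  (Ck_quadratic 1 (0 *m J) (- (J *m s)) oO)
  (fun z v _ => (quadratic_cauchy_riemann s z v (trmx_Jmx n) (JmxJmx n) S0 SJ0).1).
have := pullback_quadratic s ix jx S0 SJ0.
rewrite /= (mxtrace_anticomm (JmxJmx n) (comm i j x ix jx) BJ) addr0.
by rewrite diff_quadratic // mul0mx add0r.
Qed.

End Characterization.

Theorem theorem3p4 (R : realType) (m n : nat)
    (M : manifold R m) (g : riemannian_metric M)
    (N : kahler_manifold R n) (V : vector_field M) (phi : M -> N)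
    (phi_smooth : smooth_map phi) :
  V_pseudo_harmonic_morphism g V phi <->
  (forall (W : set N) (f : N -> R[i]),
     open W -> phi @^-1` W !=set0 -> holomorphic_on W f ->
     V_harmonic_on g V (phi @^-1` W) (f \o phi)).
Proof.
split=> [phm W f oW _|]; first exact: V_PHM_pullback.
exact: V_PHM_of_pullback.
Qed.
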